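(* (a) Let $G_1$ and $G_2$ be $L$-cospectral graphs and let $H$ be an arbitrary regular graph. Then $H\odot G_1$ and $H\odot G_2$ are $L$-cospectral. (b) Let $G_1$ and $G_2$ be $L$-cospectral regular graphs and let $H$ be an arbitrary graph. Then $G_1\odot H$ and $G_2\odot H$ are $L$-cospectral. (c) Let $G_1$ and $G_2$ be $L$-cospectral regular graphs, and let $H_1$ and $H_2$ be another pair of $L$-cospectral regular graphs. Then $G_1\odot H_1$ and $G_2\odot H_2$ are $L$-cospectral.
   Context: All graphs are finite, simple and connected. $L(G)=D(G)-A(G)$ is the Laplacian matrix of $G$, where $A(G)$ is the adjacency matrix and $D(G)$ the diagonal matrix of vertex degrees. Two non-isomorphic graphs are called $L$-cospectral if their Laplacian matrices have the same eigenvalues with the same multiplicities. The central graph $C(G)$ of $G$ is obtained from $G$ by subdividing each edge of $G$ exactly once and joining all pairs of distinct vertices of $G$ that are nonadjacent in $G$. For graphs $G,G'$, the central vertex corona $G\odot G'$ is obtained by taking one copy of $C(G)$ and $|V(G)|$ copies of $G'$, and joining the $i$-th vertex $v_i$ of $G$ (viewed in $C(G)$) to every vertex in the $i$-th copy of $G'$, for each $i$. *)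

(* Defs.v *)
From mathcomp Require Import all_boot all_order all_algebra all_field.

Set Implicit Arguments.
Unset Strict Implicit.
Unset Printing Implicit Defensive.

Import GRing.Theory.

(* Every graph is finite, simple, nonempty and connected. *)
Record graph := Graph {
  vertex :> finType;
  adj : rel vertex;
  adj_sym : symmetric adj;
  adj_irr : irreflexive adj;
  graph_nonempty : 0 < #|vertex|;
  graph_connected : forall x y, connect adj x y
}.

Definition degree (G : graph) (x : G) : nat := #|[set y | adj x y]|.

Definition regular (G : graph) : Prop :=
  exists k : nat, forall x : G, degree x = k.

Definition isomorphic (G G' : graph) : Prop :=
  exists2 f : G -> G', bijective f & forall x y, adj (f x) (f y) = adj x y.

(* Matrices are indexed by the canonical enumeration of the vertices; their    *)
(* entries lie in the algebraic complex numbers, so that every eigenvalue of   *)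
(* an integer matrix is available.                                             *)
Definition adjacency_mx (G : graph) : 'M[algC]_#|G| :=
  (\matrix_(i, j) (adj (enum_val i) (enum_val j))%:R)%R.

Definition degree_mx (G : graph) : 'M[algC]_#|G| :=
  diag_mx (\row_i (degree (enum_val i))%:R)%R.

Definition laplacian (G : graph) : 'M[algC]_#|G| :=
  (degree_mx G - adjacency_mx G)%R.

Definition eig_mult n (A : 'M[algC]_n) (a : algC) : nat := mup a (char_poly A).

Definition L_cospectral (G G' : graph) : Prop :=
  ~ isomorphic G G' /\
  forall a : algC, eig_mult (laplacian G) a = eig_mult (laplacian G') a.

Definition edges (G : graph) : {set {set G}} :=
  [set [set p.1; p.2] | p in [pred p : G * G | adj p.1 p.2]].

Section CentralGraph.

Variable G : graph.

(* [inr e] is the vertex subdividing the edge [e]. *)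
Definition central_vertex : finType := (G + {e : {set G} | e \in edges G})%type.

Definition central_adj (u v : central_vertex) : bool :=
  match u, v with
  | inl x, inl y => (x != y) && ~~ adj x y
  | inl x, inr e | inr e, inl x => x \in val e
  | inr _, inr _ => false
  end.

Lemma central_adj_sym : symmetric central_adj.
Proof. by move=> [x|e] [y|f] //=; rewrite eq_sym adj_sym. Qed.

Lemma central_adj_irr : irreflexive central_adj.
Proof. by move=> [x|e] //=; rewrite eqxx. Qed.

Lemma central_nonempty : 0 < #|central_vertex|.
Proof. by rewrite card_sum addn_gt0 graph_nonempty. Qed.

Lemma central_connect_inl (x y : G) : connect central_adj (inl x) (inl y).
Proof.
have /connectP[p] := graph_connected x y.
elim: p x => [x _ -> //|z p IHp x /= /andP[xz pz] yE].
apply: connect_trans (IHp z pz yE).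
have eP : [set x; z] \in edges G by apply/imsetP; exists (x, z).
by apply: (@connect_trans _ _ (inr (exist _ [set x; z] eP)));
  apply: connect1; rewrite /= !inE eqxx ?orbT.
Qed.

Lemma central_connected (u v : central_vertex) : connect central_adj u v.
Proof.
have sym := sym_connect_sym central_adj_sym.
have H (w : central_vertex) : exists x : G, connect central_adj (inl x) w.
  case: w => [x|[e eP]]; first by exists x.
  have /imsetP[[x y] _ eE] := eP; exists x.
  by apply: connect1; rewrite /= eE !inE eqxx.
have [[x xu] [y yv]] := (H u, H v).
apply: connect_trans yv; rewrite sym; apply: connect_trans xu.
exact: central_connect_inl.
Qed.

Definition central_graph : graph :=
  Graph central_adj_sym central_adj_irr central_nonempty central_connected.

End CentralGraph.

Section CentralVertexCorona.

Variables G G' : graph.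

(* [inr (v, y)] is the vertex [y] of the copy of [G'] attached to [v]. *)
Definition corona_vertex : finType := (central_graph G + G * G')%type.

Definition corona_adj (u v : corona_vertex) : bool :=
  match u, v with
  | inl x, inl y => adj x y
  | inl x, inr (i, _) | inr (i, _), inl x => x == inl i
  | inr (i, y), inr (j, z) => (i == j) && adj y z
  end.

Lemma corona_adj_sym : symmetric corona_adj.
Proof.
move=> [x|[i y]] [z|[j w]] //=; first exact: central_adj_sym.
by rewrite eq_sym adj_sym.
Qed.

Lemma corona_adj_irr : irreflexive corona_adj.
Proof. by move=> [x|[i y]] /=; rewrite ?central_adj_irr ?adj_irr ?andbF. Qed.

Lemma corona_nonempty : 0 < #|corona_vertex|.
Proof. by rewrite card_sum addn_gt0 graph_nonempty. Qed.

Lemma corona_connect_inl (x y : central_graph G) :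
  connect corona_adj (inl x) (inl y).
Proof.
have /connectP[p] := graph_connected x y.
elim: p x => [x _ -> //|z p IHp x /= /andP[xz pz] yE].
by apply: connect_trans (IHp z pz yE); apply: connect1.
Qed.

Lemma corona_connected (u v : corona_vertex) : connect corona_adj u v.
Proof.
have sym := sym_connect_sym corona_adj_sym.
have H (w : corona_vertex) : exists x, connect corona_adj (inl x) w.
  case: w => [x|[i y]]; first by exists x.
  by exists (inl i); apply: connect1; rewrite /= eqxx.
have [[x xu] [y yv]] := (H u, H v).
apply: connect_trans yv; rewrite sym; apply: connect_trans xu.
exact: corona_connect_inl.
Qed.

Definition central_vertex_corona : graph :=
  Graph corona_adj_sym corona_adj_irr corona_nonempty corona_connected.

End CentralVertexCorona.

Notation "G ⊙ G'" := (central_vertex_corona G G')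
  (at level 40, left associativity).

(* Main.v *)
Require Import Defs.
From mathcomp Require Import all_boot all_order all_algebra all_field perm.
From mathcomp Require Import ring zify.

Set Implicit Arguments.
Unset Strict Implicit.
Unset Printing Implicit Defensive.

Import GRing.Theory Num.Theory.

(** All three parts are instances of one statement, [L_cospectral_corona]: if
    [G1], [G2] are regular with the same Laplacian spectrum, [H1], [H2] have the
    same Laplacian spectrum, and at least one of the two pairs is not
    isomorphic, then [G1 ⊙ H1] and [G2 ⊙ H2] are L-cospectral.

    Spectrum. Let [G] be [r]-regular with [n] vertices and [m] edges, and let
    [G'] have [p] vertices. In [x - L(G ⊙ G')], the copies of [G'] form a block
    diagonal matrix with [n] blocks [x - 1 - L(G')], each sending the all-ones
    vector to [x - 1] times itself, and the subdividing vertices form the block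
    [x - 2]. Eliminating these two blocks by Schur complements
    ([char_corona_core]) leaves on the vertices of [G] the matrix
    [a + b L(G) + J], where [J] is the all-ones matrix and [a], [b] are rational
    functions of [x] depending on [n], [p], [r] only; the incidence matrix
    disappears because [R R^T = A + r]. Since [L(G) J = 0], one has
    [a (a + b L + J) = (a + b L) (a + J)] ([det_add_annihilated]), so the
    determinant depends only on [n], [p], [r], [m] and the two spectra
    ([cospectral_corona]). Finally [n] and [p] are degrees of characteristic
    polynomials, [r] is read off the trace of [L(G)], and [2 m = n r].

    Non-isomorphism. If two coronas with the same [n] and [p] are isomorphic,
    then so are the left factors, and so are the right factors. Unless the
    graphs are tiny, the vertices of [G] are exactly the vertices of degree
    [n - 1 + p], so an isomorphism preserves them; their adjacency is the
    complement of that of [G] ([corona_iso_left]), and once they are deleted the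
    copies of [G'] are the components with an edge ([corona_iso_right_copy]).
    When [n = 1] the corona is the join of a vertex with [G'], and the
    isomorphism is corrected at one vertex ([corona_iso_right_join]). *)

(** * Degrees and incidences *)

Section Counting.

Lemma degreeE (G : graph) (x : G) : degree x = \sum_y adj x y.
Proof. by rewrite /degree cardsE -sum1_card big_mkcond. Qed.

Variable G : graph.

Notation edge := {e : {set G} | e \in edges G}.

Lemma edgeP (e : {set G}) :
  reflect (exists x y, adj x y /\ e = [set x; y]) (e \in edges G).
Proof.
apply: (iffP imsetP) => [[[x y] xy ->]|[x [y [xy ->]]]]; first by exists x, y.
by exists (x, y).
Qed.

Lemma card_edge (e : {set G}) : e \in edges G -> #|e| = 2.
Proof.
case/edgeP=> x [y [xy ->]]; rewrite cards2; case: eqP xy => // ->.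
by rewrite adj_irr.
Qed.

(** The edges at [x] are parametrized by the neighbors of [x]. *)
Lemma edge_at (x : G) (e : {set G}) :
  (e \in edges G) && (x \in e) = (e \in [set [set x; y] | y in [pred y | adj x y]]).
Proof.
apply/andP/imsetP => [[/edgeP[y [z [yz ->]]]]|[y xy ->]].
  by rewrite !inE => /orP[]/eqP->; [exists z|exists y; rewrite ?inE 1?adj_sym // setUC].
by rewrite !inE eqxx; split=> //; apply/edgeP; exists x, y.
Qed.

Lemma sum_incidence (x : G) : \sum_(e : edge) (x \in val e) = degree x.
Proof.
rewrite -(big_sub (edges G) (fun e => nat_of_bool (x \in e))) /=.
rewrite -big_mkcondr sum1_card (eq_card (edge_at x)) card_in_imset.
  by rewrite /degree cardsE; apply: eq_card.
move=> y z; rewrite !inE => xy xz /setP/(_ y).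
rewrite !inE eqxx orbT; case: (y =P x) => [yx|_ /esym/eqP//].
by rewrite yx adj_irr in xy.
Qed.

(** The off-diagonal entries of [R R^T], for [R] the incidence matrix. *)
Lemma sum_incidence2 (x y : G) : x != y ->
  \sum_(e : edge) ((x \in val e) && (y \in val e)) = adj x y.
Proof.
move=> neq_xy.
rewrite -(big_sub (edges G) (fun e => nat_of_bool ((x \in e) && (y \in e)))) /=.
rewrite -big_mkcondr sum1_card -[RHS]mul1n.
have eq_e e : (e \in edges G) && ((x \in e) && (y \in e))
              = adj x y && (e == [set x; y]).
  rewrite andbA edge_at; apply/andP/andP => [[/imsetP[z xz ->]]|[xy /eqP->]].
    by rewrite !inE eq_sym (negPf neq_xy) /= => /eqP->.
  by rewrite !inE eqxx orbT; split=> //; apply/imsetP; exists y.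
rewrite (eq_card eq_e); case: (adj x y); last by rewrite eq_card0.
by rewrite (eq_card (B := pred1 [set x; y])) ?card1.
Qed.

Lemma handshake k : (forall x : G, degree x = k) -> #|G| * k = #|{: edge}| * 2.
Proof.
move=> degk; rewrite -!sum_nat_const -(eq_bigr _ (fun x _ => degk x)).
rewrite -(eq_bigr _ (fun x _ => sum_incidence x)) exchange_big /=.
apply: eq_bigr => e _; rewrite -(card_edge (valP e)) -sum1_card.
by rewrite [RHS]big_mkcond.
Qed.

End Counting.

Section CoronaDegree.

Variables G G' : graph.

Lemma degree_copy (i : G) (y : G') :
  @degree (G ⊙ G') (inr (i, y)) = (degree y).+1.
Proof.
rewrite degreeE big_sumType /= big_sumType /=.
rewrite [X in _ + X + _]big1 // addn0 (bigD1 i) //= eqxx big1 ?addn0; last first.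
  by move=> j /negPf; rewrite (inj_eq inl_inj) => ->.
rewrite degreeE add1n; congr _.+1.
rewrite (eq_bigr (fun p => (i == p.1) && adj y p.2 : nat)) => [|[]] //.
rewrite -(pair_bigA _ (fun j z => (i == j) && adj y z : nat)) /=.
rewrite (bigD1 i) //= eqxx [X in _ + X]big1 ?addn0 // => j /negPf.
by rewrite eq_sym => ->; rewrite big1.
Qed.

Lemma degree_edge (e : {e : {set G} | e \in edges G}) :
  @degree (G ⊙ G') (inl (inr e)) = 2.
Proof.
rewrite degreeE big_sumType /= big_sumType /=.
rewrite [X in _ + X + _]big1 // [X in _ + X]big1 => [|[] //].
by rewrite !addn0 -(card_edge (valP e)) -sum1_card [RHS]big_mkcond.
Qed.

(** An original vertex [v] meets its non-neighbors, its incident edges and its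
    copy of [G'], hence a number of vertices independent of [v]. *)
Lemma degree_core (v : G) :
  @degree (G ⊙ G') (inl (inl v)) = #|G|.-1 + #|G'|.
Proof.
rewrite degreeE big_sumType /= big_sumType /=; congr (_ + _).
  rewrite sum_incidence degreeE -big_split /= -(cardC1 v) -sum1_card.
  rewrite [RHS]big_mkcond; apply: eq_bigr => w _ /=.
  rewrite inE eq_sym; case: eqP => [->|]; first by rewrite adj_irr.
  by case: adj.
rewrite (eq_bigr (fun p => (v == p.1) : nat)) => [|[i y] _]; last first.
  by rewrite (inj_eq inl_inj).
rewrite -(pair_bigA _ (fun i (y : G') => (v == i) : nat)) /=.
rewrite (bigD1 v) //= eqxx sum_nat_const muln1 [X in _ + X]big1 ?addn0 // => i /negPf.
by rewrite eq_sym => ->; rewrite big1.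
Qed.

End CoronaDegree.

(** * Recovering the factors from the corona *)

Lemma isomorphic_inj (G G' : graph) (f : G -> G') :
  #|G| = #|G'| -> injective f -> (forall x y, adj (f x) (f y) = adj x y) ->
  isomorphic G G'.
Proof.
move=> GG' f_inj f_adj; exists f => //.
by apply: inj_card_bij f_inj _; rewrite GG'.
Qed.

Lemma degree_iso (G G' : graph) (f : G -> G') x : bijective f ->
  (forall x y, adj (f x) (f y) = adj x y) -> degree (f x) = degree x.
Proof.
move=> f_bij f_adj; rewrite !degreeE (reindex f) /=; last exact: onW_bij.
by apply: eq_bigr => y _; rewrite f_adj.
Qed.

Lemma degree_lt (G : graph) (x : G) : degree x < #|G|.
Proof.
rewrite -cardsT; apply: proper_card; rewrite properT.
by apply/eqP=> /setP/(_ x); rewrite !inE adj_irr.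
Qed.

Lemma has_neighbor (G : graph) (x y : G) : x != y -> exists z, adj x z.
Proof.
move=> neq_xy; have /connectP[[|z p] /=] := graph_connected x y.
  by move=> _ yx; rewrite yx eqxx in neq_xy.
by case/andP=> xz _ _; exists z.
Qed.

(** A connected graph on at most two vertices is complete. *)
Lemma adj_small (G : graph) (x y : G) : #|G| <= 2 -> adj x y = (x != y).
Proof.
move=> G2; have [->|neq_xy] := eqVneq x y; first by rewrite adj_irr.
have [z xz] := has_neighbor neq_xy.
have [<-//|neq_yz] := eqVneq z y.
have neq_xz : x != z by apply: contraTneq xz => ->; rewrite adj_irr.
suff : 2 < #|G| by rewrite ltnNge G2.
apply: leq_trans (max_card (mem [:: x; y; z])).
rewrite (card_uniqP _) //= !inE negb_or neq_xy neq_xz /=.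
by rewrite eq_sym neq_yz.
Qed.

Lemma isomorphic_small (G G' : graph) : #|G| = #|G'| -> #|G| <= 2 -> isomorphic G G'.
Proof.
move=> GG' G2.
have f_inj : injective (fun x : G => enum_val (cast_ord GG' (enum_rank x))).
  by move=> x y /enum_val_inj/cast_ord_inj/enum_rank_inj.
apply: (isomorphic_inj GG' f_inj) => x y.
by rewrite !adj_small -?GG' // (inj_eq f_inj).
Qed.

(** The vertices of the corona that are original vertices of [G]. *)
Definition is_core (G G' : graph) (u : G ⊙ G') : bool :=
  if u is inl (inl _) then true else false.

(** The excluded case with [1 < #|G|] is [K_2 ⊙ K_1], where the subdividing
    vertex also has degree two. *)
Lemma is_core_degree (G G' : graph) (u : G ⊙ G') : 1 < #|G| -> 4 <= #|G| + #|G'| ->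
  is_core u = (degree u == #|G|.-1 + #|G'|).
Proof.
move=> G2 GG'4; case: u => [[v|e]|[i y]] /=.
- by rewrite degree_core eqxx.
- rewrite degree_edge; apply/esym/negbTE/eqP; move: G2 GG'4.
  by set n := #|G|; set p := #|G'|; lia.
- rewrite degree_copy; apply/esym/negbTE/eqP; move: (degree_lt y) G2.
  by set n := #|G|; set p := #|G'|; lia.
Qed.

Section CoronaIso.

Variables (G1 G2 H1 H2 : graph) (f : G1 ⊙ H1 -> G2 ⊙ H2).
Hypotheses (eqG : #|G1| = #|G2|) (eqH : #|H1| = #|H2|).
Hypotheses (f_bij : bijective f) (f_adj : forall x y, adj (f x) (f y) = adj x y).

Lemma is_core_iso u : 1 < #|G1| -> 4 <= #|G1| + #|H1| -> is_core (f u) = is_core u.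
Proof.
by move=> G1_gt1 GH; rewrite !is_core_degree -?eqG -?eqH ?degree_iso.
Qed.

(** Two original vertices are adjacent in the corona exactly when they are
    distinct and nonadjacent in the left factor. *)
Lemma corona_iso_left : isomorphic G1 G2.
Proof.
have [le2|G1_gt2] := leqP #|G1| 2; first exact: isomorphic_small.
have core v : exists w, f (inl (inl v)) = inl (inl w).
  have : is_core (f (inl (inl v))).
    by rewrite is_core_iso ?(ltnW G1_gt2) //; have := graph_nonempty H1; lia.
  by case: (f _) => [[w|]|] // _; exists w.
have [g gP] := fin_all_exists core.
have g_inj : injective g.
  move=> v w gvw; have : f (inl (inl v)) = f (inl (inl w)) by rewrite !gP gvw.
  by move/(bij_inj f_bij) => [].
apply: (isomorphic_inj eqG g_inj) => v w.
have [->|neq_vw] := eqVneq v w; first by rewrite !adj_irr.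
have := f_adj (inl (inl v)) (inl (inl w)).
by rewrite !gP /= (inj_eq g_inj) neq_vw /= => /negb_inj.
Qed.

(** Here the coronas are joins of a single vertex, the apex, with [H1] and [H2];
    [f] need not send one apex to the other. *)
Lemma corona_iso_right_join : #|G1| = 1 -> isomorphic H1 H2.
Proof.
move=> G1_1; have G2_1 : #|G2| = 1 by rewrite -eqG.
have [a aP] : exists a : G1, forall x, x = a.
  by have /eqP/fintype1P[a aP] := G1_1; exists a.
have [b bP] : exists b : G2, forall x, x = b.
  by have /eqP/fintype1P[b bP] := G2_1; exists b.
have vertexP (u : G2 ⊙ H2) : u = inl (inl b) \/ exists y, u = inr (b, y).
  case: u => [[x|[e eP]]|[x y]]; rewrite ?(bP x); [by left| |by right; exists y].
  have := card_edge eP; have := max_card (mem e).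
  by rewrite G2_1 => + e2; rewrite e2.
have [y0 fa] : exists y0,
    f (inl (inl a)) = inl (inl b) \/ f (inl (inl a)) = inr (b, y0).
  case: (vertexP (f (inl (inl a)))) => [->|[y ->]]; last by exists y; right.
  by have /card_gt0P[y0 _] := graph_nonempty H2; exists y0; left.
(* At most one vertex of [H1] is sent by [f] to the apex [b]. If there is one,
   [g] sends it to the image [y0] of the apex [a] instead, which is adjacent to
   every other vertex of [H2]; if there is none, [y0] is never used. *)
pose g y := if f (inr (a, y)) is inr (_, w) then w else y0.
have fP y : f (inr (a, y)) = inl (inl b) /\ f (inl (inl a)) = inr (b, g y)
            \/ f (inr (a, y)) = inr (b, g y).
  rewrite /g; case: (vertexP (f (inr (a, y)))) => [fy|[w ->]]; last by right.
  rewrite fy; left; split=> //; case: fa => // fa; rewrite -fy in fa.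
  by move/(bij_inj f_bij): fa.
have f_inj := bij_inj f_bij.
have a_adj y : adj (f (inl (inl a))) (f (inr (a, y))) by rewrite f_adj /= eqxx.
have copy_adj y z : adj (f (inr (a, y))) (f (inr (a, z))) = adj y z.
  by rewrite f_adj /= eqxx.
apply: (@isomorphic_inj _ _ g) => // [y z gyz|y z].
  suff /f_inj[] : f (inr (a, y)) = f (inr (a, z)) by [].
  case: (fP y) (fP z) => [[fy fay]|fy] [[fz faz]|fz]; rewrite fy fz ?gyz //.
    by move: fay; rewrite gyz -fz => /f_inj.
  by move: faz; rewrite -gyz -fy => /f_inj.
rewrite -copy_adj; have := a_adj y; have := a_adj z.
case: (fP y) (fP z) => [[fy fay]|fy] [[fz faz]|fz].
- have /f_inj[->] : f (inr (a, y)) = f (inr (a, z)) by rewrite fy fz.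
  by rewrite !adj_irr.
- by rewrite fay fy fz /= !eqxx.
- by rewrite faz fy fz /= !eqxx adj_sym.
- by rewrite fy fz /= eqxx.
Qed.

(** The copy of [H1] attached to a vertex [i] is connected and has an edge at
    each vertex, so its image avoids the subdividing vertices and lies in a single
    copy of [H2]. *)
Lemma corona_iso_right_copy : 1 < #|G1| -> 1 < #|H1| -> isomorphic H1 H2.
Proof.
move=> G1_gt1 H1_gt1; have /card_gt0P[i _] := graph_nonempty G1.
have coreF u : is_core (f u) = is_core u by apply: is_core_iso => //; lia.
have copy y : exists q, f (inr (i, y)) = inr q.
  have [y' yy'] : exists z, adj y z.
    have : 0 < #|predC1 y| by have := cardC1 y; lia.
    by case/card_gt0P=> y'; rewrite inE eq_sym => /has_neighbor.
  have := f_adj (inr (i, y)) (inr (i, y')); rewrite /= eqxx yy' /=.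
  have := coreF (inr (i, y)); have := coreF (inr (i, y')).
  case: (f (inr (i, y))) => [[|e]|q] //; last by exists q.
  by case: (f (inr (i, y'))) => [[]|[]].
have [q qP] := fin_all_exists copy.
have q_adj y z : ((q y).1 == (q z).1) && adj (q y).2 (q z).2 = adj y z.
  have := f_adj (inr (i, y)) (inr (i, z)); rewrite /= eqxx /= !qP.
  by case: (q y) (q z) => [j u] [k w].
have q1 y z : (q y).1 = (q z).1.
  have /connectP[p] := graph_connected y z.
  elim: p y => [|x p IHp] y /=; first by move=> _ ->.
  by rewrite -q_adj => /andP[/andP[/eqP-> _] xp] /(IHp _ xp).
apply: (@isomorphic_inj _ _ (fun y => (q y).2)) => // [y z yz|y z].
  have /(bij_inj f_bij)[] // : f (inr (i, y)) = f (inr (i, z)).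
  by rewrite !qP; congr inr; apply: injective_projections (q1 y z) yz.
by rewrite -q_adj (q1 y z) eqxx.
Qed.

Lemma corona_iso_right : isomorphic H1 H2.
Proof.
have [le1|H1_gt1] := leqP #|H1| 1; first exact/isomorphic_small/leqW.
have [le1|G1_gt1] := leqP #|G1| 1; last exact: corona_iso_right_copy.
by apply: corona_iso_right_join; apply/eqP; rewrite eqn_leq le1 graph_nonempty.
Qed.

End CoronaIso.

(** * Determinants indexed by finite types *)

Section FinDet.

Local Open Scope ring_scope.

Variable R : comNzRingType.

(** The determinant of a square matrix whose rows and columns are indexed by a
    finite type, computed along its canonical enumeration; by [fdet_enum] any
    other enumeration gives the same value. *)
Definition fdet (T : finType) (M : T -> T -> R) : R :=
  \det (\matrix_(i < #|T|, j < #|T|) M (enum_val i) (enum_val j)).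

Lemma eq_fdet (T : finType) (M N : T -> T -> R) : M =2 N -> fdet M = fdet N.
Proof.
by move=> MN; congr (\det _); apply/matrixP=> i j; rewrite !mxE MN.
Qed.

Lemma fdet_enum (T : finType) (M : T -> T -> R) n (e : 'I_n -> T) :
  bijective e -> fdet M = \det (\matrix_(i < n, j < n) M (e i) (e j)).
Proof.
move=> e_bij; have nE : n = #|T| by rewrite -(bij_eq_card e_bij) card_ord.
subst n; have s_inj : injective (fun i => enum_rank (e i)).
  by apply: inj_comp (bij_inj e_bij); apply: enum_rank_inj.
pose s := perm s_inj.
pose A := \matrix_(i < #|T|, j < #|T|) M (enum_val i) (enum_val j).
have -> : \matrix_(i, j) M (e i) (e j) = row_perm s (col_perm s A).
  by apply/matrixP=> i j; rewrite !mxE !permE /= !enum_rankK.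
rewrite row_permE col_permE !det_mulmx !det_perm odd_permV.
by rewrite mulrCA -signr_addb addbb mulr1.
Qed.

Lemma fdet_bij (S T : finType) (h : S -> T) (M : T -> T -> R) :
  bijective h -> fdet M = fdet (fun x y => M (h x) (h y)).
Proof.
by move=> h_bij; apply/fdet_enum/bij_comp => //; apply: enum_val_bij.
Qed.

(** Schur complement with respect to the block [D] indexed by [T]: it suffices
    to know a solution [X] of [D X = C], so [D] need not be invertible. *)
Lemma fdet_schur (S T : finType) (M : S + T -> S + T -> R) (X : T -> S -> R) :
  (forall t s, \sum_u M (inr t) (inr u) * X u s = M (inr t) (inl s)) ->
  fdet M = fdet (fun t u => M (inr t) (inr u)) *
    fdet (fun s s' => M (inl s) (inl s') - \sum_u M (inl s) (inr u) * X u s').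
Proof.
move=> XP.
pose e (k : 'I_(#|S| + #|T|)) : S + T :=
  match split k with inl i => inl (enum_val i) | inr j => inr (enum_val j) end.
have e_bij : bijective e.
  exists (fun x => unsplit (match x with
    | inl s => inl (enum_rank s) | inr t => inr (enum_rank t) end)).
    move=> k; rewrite /e -{2}(splitK k).
    by case: (split k) => i; rewrite enum_valK.
  by case=> x; rewrite /e unsplitK enum_rankK.
have eL i : e (lshift _ i) = inl (enum_val i).
  by rewrite /e (unsplitK (inl i)).
have eR i : e (rshift _ i) = inr (enum_val i).
  by rewrite /e (unsplitK (inr i)).
rewrite (fdet_enum _ e_bij).
pose A := \matrix_(i < #|S|, j < #|S|) M (inl (enum_val i)) (inl (enum_val j)).
pose B := \matrix_(i < #|S|, j < #|T|) M (inl (enum_val i)) (inr (enum_val j)).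
pose C := \matrix_(i < #|T|, j < #|S|) M (inr (enum_val i)) (inl (enum_val j)).
pose D := \matrix_(i < #|T|, j < #|T|) M (inr (enum_val i)) (inr (enum_val j)).
pose Y := \matrix_(i < #|T|, j < #|S|) X (enum_val i) (enum_val j).
have -> : \matrix_(i, j) M (e i) (e j) = block_mx A B C D.
  apply/matrixP=> i j; rewrite mxE -(splitK i) -(splitK j).
  by case: (split i) => i'; case: (split j) => j';
    rewrite /= ?block_mxEul ?block_mxEur ?block_mxEdl ?block_mxEdr mxE ?eL ?eR.
have DY : D *m Y = C.
  apply/matrixP=> i j; rewrite !mxE -XP [RHS](reindex _ (onW_bij _ (enum_val_bij T))) /=.
  by apply: eq_bigr => k _; rewrite !mxE.
have /(congr1 determinant) :
    block_mx A B C D *m block_mx 1%:M 0 (- Y) 1%:M = block_mx (A - B *m Y) B 0 D.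
  by rewrite mulmx_block !mulmx1 !mulmx0 !add0r !mulmxN DY subrr.
rewrite det_mulmx det_lblock !det1 !mulr1 det_ublock mulrC => ->.
congr (_ * _); congr (\det _); apply/matrixP=> i j; rewrite !mxE.
rewrite [X in _ = _ - X](reindex _ (onW_bij _ (enum_val_bij T))) /=.
by congr (_ - _); apply: eq_bigr => k _; rewrite !mxE.
Qed.

Lemma fdet_sum (S T : finType) (M : S + T -> S + T -> R) :
  (forall t s, M (inr t) (inl s) = 0) ->
  fdet M = fdet (fun t u => M (inr t) (inr u)) *
           fdet (fun s s' => M (inl s) (inl s')).
Proof.
move=> M0; rewrite (@fdet_schur _ _ _ (fun _ _ => 0)).
  by congr (_ * _); apply: eq_fdet => s s'; rewrite big1 ?subr0 // => u; rewrite mulr0.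
by move=> t s; rewrite M0 big1 // => u; rewrite mulr0.
Qed.

(** The determinant of the Kronecker product of an identity matrix and [B]. *)
Lemma fdet_diag (S T : finType) (B : T -> T -> R) :
  fdet (fun x y : S * T => (x.1 == y.1)%:R * B x.2 y.2) = fdet B ^+ #|S|.
Proof.
have H n : fdet (fun x y : 'I_n * T => (x.1 == y.1)%:R * B x.2 y.2)
           = fdet B ^+ n.
  elim: n => [|n IHn].
    rewrite expr0 (@fdet_enum _ _ 0 (fun i : 'I_0 => False_rect _ (notF (valP i)))).
      by rewrite det_mx00.
    by exists (fun x : 'I_0 * T => x.1) => [[]|[[]]].
  pose h (x : 'I_n * T + T) : 'I_n.+1 * T :=
    match x with inl (i, t) => (lift ord0 i, t) | inr t => (ord0, t) end.
  have h_bij : bijective h.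
    exists (fun x : 'I_n.+1 * T => match unlift ord0 x.1 with
      | Some i => inl (i, x.2) | None => inr x.2 end).
      by case=> [[i t]|t]; rewrite /= ?liftK ?unlift_none.
    by case=> i t /=; case: unliftP => [j|] ->.
  rewrite (fdet_bij _ h_bij) fdet_sum; last first.
    by move=> t [i u]; rewrite mul0r.
  rewrite exprS -IHn; congr (_ * _).
    by apply: eq_fdet => t u; rewrite eqxx mul1r.
  by apply: eq_fdet => -[i t] [j u]; rewrite /= (inj_eq lift_inj).
have h_bij : bijective (fun x : 'I_#|S| * T => (enum_val x.1, x.2)).
  exists (fun x : S * T => (enum_rank x.1, x.2)) => -[i t] /=.
    by rewrite enum_valK.
  by rewrite enum_rankK.
rewrite -H (fdet_bij _ h_bij); apply: eq_fdet => x y /=.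
by rewrite (inj_eq enum_val_inj).
Qed.

End FinDet.

(** * Laplacian characteristic polynomials *)

Section CharPoly.

Local Open Scope ring_scope.

Lemma horner_char_poly (R : comNzRingType) n (A : 'M[R]_n) x :
  (char_poly A).[x] = \det (x%:M - A).
Proof.
rewrite -horner_evalE -det_map_mx; congr (\det _); apply/matrixP=> i j.
by rewrite !mxE /= horner_evalE hornerD hornerN hornerC hornerMn hornerX.
Qed.

Lemma det_affine_char_poly (F : fieldType) n (A : 'M[F]_n) a b : b != 0 ->
  \det (a%:M + b *: A) = (- b) ^+ n * (char_poly A).[- (a / b)].
Proof.
move=> b0; rewrite horner_char_poly -detZ; congr (\det _).
by rewrite scalerBr scale_scalar_mx mulrNN mulrCA divff // mulr1 scaleNr opprK.
Qed.

Lemma det_add_annihilated (R : comNzRingType) n (L J : 'M[R]_n) a b :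
  L *m J = 0 ->
  a ^+ n * \det (a%:M + b *: L + J) = \det (a%:M + b *: L) * \det (a%:M + J).
Proof.
move=> LJ; rewrite -detZ -det_mulmx; congr (\det _).
rewrite mulmxDl !mulmxDr -!scalemxAl LJ scaler0 addr0.
rewrite !mul_mx_scalar mul_scalar_mx.
by rewrite !scalerDr addrAC !scalerA (mulrC b).
Qed.

(** Polynomials that agree outside the roots of a nonzero polynomial are equal. *)
Lemma poly_eq_off (p q d : {poly algC}) : d != 0 ->
  (forall x, d.[x] != 0 -> p.[x] = q.[x]) -> p = q.
Proof.
move=> d0 pq; apply/eqP; rewrite -subr_eq0; apply: contraT => pq0.
pose rs := [seq i%:R : algC | i <- iota 0 (size ((p - q) * d))].
have := @max_poly_roots _ ((p - q) * d) rs.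
rewrite mulf_neq0 // size_map size_iota ltnn; apply => //.
  apply/allP=> x _; rewrite /root hornerM hornerD hornerN mulf_eq0.
  by have [_|/pq->] := eqVneq d.[x] 0; rewrite ?orbT ?subrr ?eqxx.
rewrite map_inj_uniq ?iota_uniq // => i j /eqP.
by rewrite eqr_nat => /eqP.
Qed.

(** Over an algebraically closed field a monic polynomial is determined by the
    multiplicities of its roots. *)
Lemma eq_char_poly m n (A : 'M[algC]_m) (B : 'M[algC]_n) :
  (forall a, eig_mult A a = eig_mult B a) -> char_poly A = char_poly B.
Proof.
move=> AB.
have [r rE] := closed_field_poly_normal (char_poly A).
have [s sE] := closed_field_poly_normal (char_poly B).
rewrite (monicP (char_poly_monic _)) scale1r in rE.
rewrite (monicP (char_poly_monic _)) scale1r in sE.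
rewrite rE sE; apply: perm_big; apply/allP=> a _ /=.
by rewrite -!mu_prod_XsubC -rE -sE; apply/eqP/AB.
Qed.

Lemma laplacianE (G : graph) (i j : 'I_#|G|) :
  laplacian G i j = (i == j)%:R * (degree (enum_val i))%:R
                    - (adj (enum_val i) (enum_val j))%:R.
Proof. by rewrite !mxE mulr_natl. Qed.

Lemma char_laplacian (G : graph) x : (char_poly (laplacian G)).[x] =
  fdet (fun u v : G => (u == v)%:R * (x - (degree u)%:R) + (adj u v)%:R).
Proof.
rewrite horner_char_poly; congr (\det _); apply/matrixP=> i j.
rewrite [LHS]mxE [X in _ + X]mxE laplacianE !mxE (inj_eq enum_val_inj).
rewrite -[x *+ _]mulr_natl; ring.
Qed.

Lemma laplacian_const (G : graph) : laplacian G *m const_mx 1 = 0 :> 'M_#|G|.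
Proof.
apply/matrixP=> i j; rewrite !mxE.
under eq_bigr do rewrite laplacianE mxE mulr1.
rewrite big_split sumrN /= (bigD1 i) //= eqxx mul1r big1 => [|k /negPf]; last first.
  by rewrite eq_sym => ->; rewrite mul0r.
rewrite addr0 degreeE natr_sum (reindex _ (onW_bij _ (enum_val_bij G))) /=.
by rewrite subrr.
Qed.

Lemma cospectral_card (G1 G2 : graph) :
  char_poly (laplacian G1) = char_poly (laplacian G2) -> #|G1| = #|G2|.
Proof.
by move/(congr1 (fun p : {poly _} => size p)); rewrite !size_char_poly => -[].
Qed.

Lemma tr_laplacian (G : graph) : \tr (laplacian G) = (\sum_(x : G) degree x)%:R.
Proof.
rewrite natr_sum (reindex _ (onW_bij _ (enum_val_bij G))) /=.
by apply: eq_bigr => i _; rewrite laplacianE eqxx mul1r adj_irr subr0.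
Qed.

Lemma cospectral_regular (G1 G2 : graph) k1 k2 :
  (forall x : G1, degree x = k1) -> (forall x : G2, degree x = k2) ->
  char_poly (laplacian G1) = char_poly (laplacian G2) -> k1 = k2.
Proof.
move=> deg1 deg2 eq12; have n12 := cospectral_card eq12.
have /eqP : \tr (laplacian G1) = \tr (laplacian G2).
  by apply: oppr_inj; rewrite -!char_poly_trace ?graph_nonempty // eq12 n12.
rewrite !tr_laplacian eqr_nat (eq_bigr _ (fun x _ => deg1 x)).
rewrite (eq_bigr _ (fun x _ => deg2 x)).
by rewrite !sum_nat_const -n12 eqn_pmul2l ?graph_nonempty // => /eqP.
Qed.

End CharPoly.

Section CoronaCharPoly.

Local Open Scope ring_scope.

Variables G G' : graph.
Variable r : nat.
Hypothesis degG : forall x : G, degree x = r.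

Notation n := #|G|.
Notation p := #|G'|.
Notation edge := {e : {set G} | e \in edges G}.

(** Characteristic polynomial of the corona of an [r]-regular graph, at a point
    where both eliminated blocks act invertibly on the vectors involved. *)
Lemma char_corona_core x : x != 1 -> x != 2 ->
  (char_poly (laplacian (G ⊙ G'))).[x] =
  (char_poly (laplacian G')).[x - 1] ^+ n * (x - 2) ^+ #|{: edge}| *
  \det ((x - n%:R - p%:R - p%:R / (x - 1) - r%:R - 2 * r%:R / (x - 2))%:M
        + ((x - 1) / (x - 2)) *: laplacian G + const_mx 1).
Proof.
rewrite -(subr_eq0 x 1) -(subr_eq0 x 2) => x1 x2.
rewrite char_laplacian.
(* The copies: each block [x - 1 - L(G')] maps the all-ones vector to [x - 1]
   times itself. *)
rewrite (fdet_schur (X := fun iy u => (u == inl iy.1)%:R / (x - 1))); last first.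
  case=> i y u /=.
  rewrite (eq_bigr (fun p : G * G' => ((i == p.1)%:R * (u == inl p.1)%:R) *
     (((y == p.2)%:R * (x - 1 - (degree y)%:R) + (adj y p.2)%:R) / (x - 1)))); last first.
    case=> j z _ /=; rewrite degree_copy.
    rewrite (inj_eq inr_inj) xpair_eqE -!mulnb !natrM -natr1.
    by ring.
  rewrite -(pair_bigA _ (fun j z => ((i == j)%:R * (u == inl j)%:R) *
     (((y == z)%:R * (x - 1 - (degree y)%:R) + (adj y z)%:R) / (x - 1)))) /=.
  rewrite (bigD1 i) //= eqxx [X in _ + X]big1 => [|j /negPf]; last first.
    by rewrite eq_sym => ->; rewrite big1 // => z _; rewrite !mul0r.
  rewrite addr0 -mulr_sumr -mulr_suml big_split -mulr_suml -natr_sum /=.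
  rewrite -natr_sum -degreeE (bigD1 y) //= eqxx big1 => [|z /negPf]; last first.
    by rewrite eq_sym => ->.
  by rewrite addn0 !mul1r subrK divff ?mulr1 ?mul0r ?add0r.
rewrite -mulrA; congr (_ * _).
  rewrite char_laplacian -fdet_diag; apply: eq_fdet => -[i y] [j z] /=.
  rewrite degree_copy (inj_eq inr_inj) xpair_eqE -!mulnb !natrM -natr1.
  by ring.
(* What remains on the central graph once the copies are eliminated. *)
pose N (u v : G + edge) : algC := match u, v with
  | inl a, inl b => (a == b)%:R * (x - (n.-1 + p)%:R - p%:R / (x - 1))
                    + ((a != b) && ~~ adj a b)%:R
  | inl a, inr e | inr e, inl a => (a \in val e)%:R
  | inr e, inr f => (e == f)%:R * (x - 2)
  end.
rewrite (@eq_fdet _ _ _ N); last first.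
  case=> [a|e] [b|f] /=; rewrite ?degree_core ?degree_edge;
    rewrite ?(inj_eq inl_inj, inj_eq inr_inj).
  - rewrite (eq_bigr (fun q : G * G' =>
      (a == q.1)%:R * (b == q.1)%:R / (x - 1))); last first.
      by case=> i y _ /=; rewrite mul0r add0r !(inj_eq inl_inj) mulrA.
    rewrite -(pair_bigA _ (fun i (y : G') => (a == i)%:R * (b == i)%:R / (x - 1))) /=.
    rewrite (bigD1 a) //= eqxx sumr_const [X in - (_ + X)]big1 => [|i /negPf]; last first.
      by rewrite eq_sym => ->; rewrite big1 // => y _; rewrite !mul0r.
    rewrite mul1r addr0 [b == a]eq_sym -[X in _ - X]mulr_natl; ring.
  - by rewrite mul0r add0r big1 ?subr0 // => -[i y] _; rewrite mul0r mulr0.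
  - by rewrite mul0r add0r big1 ?subr0 // => -[i y] _; rewrite ?mul0r add0r mul0r.
  - by rewrite addr0 big1 ?subr0 // => -[i y] _; rewrite ?mul0r add0r mul0r.
have NX e v : \sum_f N (inr e) (inr f) * ((v \in val f)%:R / (x - 2))
              = N (inr e) (inl v).
  rewrite /N (bigD1 e) //= big1 => [|f /negPf fe].
    by rewrite eqxx mul1r addr0 mulrC divfK.
  by rewrite eq_sym fe !mul0r.
apply: etrans (fdet_schur NX) _; congr (_ * _).
  rewrite -[LHS]/(\det _) -[RHS]det_scalar; congr (\det _).
  apply/matrixP=> i j; rewrite !mxE /= (inj_eq enum_val_inj).
  by rewrite mulr_natl.
congr (\det _); apply/matrixP=> i j.
rewrite [RHS]mxE [X in _ = X + _]mxE [X in _ = _ + X + _]mxE laplacianE degG.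
rewrite !mxE /= (inj_eq enum_val_inj).
set v := enum_val i; set w := enum_val j.
rewrite (eq_bigr (fun e : edge =>
  ((v \in val e) && (w \in val e))%:R / (x - 2))); last first.
  by move=> e _; rewrite -mulnb natrM mulrA.
rewrite -mulr_suml -natr_sum.
(* The diagonal of [R R^T] is [r], its off-diagonal part is the adjacency
   matrix, and both sides are compared entrywise. *)
have [ij|neq_ij] := eqVneq i j.
  rewrite /w -ij adj_irr /= (eq_bigr (fun e : edge => (v \in val e) : nat)).
    rewrite sum_incidence degG -[n in RHS](prednK (graph_nonempty G)) natrD -natr1.
    by field; rewrite x1 x2.
  by move=> e _; rewrite andbb.
have neq_vw : v != w by rewrite (inj_eq enum_val_inj).
rewrite sum_incidence2 //=.
by rewrite mulr0n; case: (adj v w) => /=; field; rewrite ?x1 ?x2.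
Qed.

End CoronaCharPoly.

(** * Cospectrality of coronas *)

Section CospectralCorona.

Local Open Scope ring_scope.

Lemma cospectral_corona (G1 G2 H1 H2 : graph) : regular G1 -> regular G2 ->
  char_poly (laplacian G1) = char_poly (laplacian G2) ->
  char_poly (laplacian H1) = char_poly (laplacian H2) ->
  char_poly (laplacian (G1 ⊙ H1)) = char_poly (laplacian (G2 ⊙ H2)).
Proof.
move=> [r1 deg1] [r2 deg2] eqG eqH.
have r12 := cospectral_regular deg1 deg2 eqG; rewrite -r12 in deg2.
have n12 := cospectral_card eqG.
have p12 := cospectral_card eqH.
have m12 : #|{: {e : {set G1} | e \in edges G1}}| =
           #|{: {e : {set G2} | e \in edges G2}}|.
  apply/eqP; rewrite -(eqn_pmul2r (isT : 0 < 2)%N) -(handshake deg1) n12.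
  by rewrite (handshake deg2).
(* [q] is the scalar term [a] of the reduced matrix with its denominators
   cleared: its value at [x]
   is [a * (x - 1) * (x - 2)], and its value at [1] is [p], which is nonzero. *)
pose n : algC := #|G1|%:R; pose p : algC := #|H1|%:R; pose r : algC := r1%:R.
pose q : {poly algC} := ('X - (n + p + r)%:P) * ('X - 1%:P) * ('X - 2%:P)
  - p *: ('X - 2%:P) - (2 * r) *: ('X - 1%:P).
pose d : {poly algC} := ('X - 1%:P) * ('X - 2%:P) * q.
have q0 : q != 0.
  apply: contraTneq (graph_nonempty H1) => /(congr1 (horner^~ 1)) /eqP.
  rewrite !hornerE subrr mulr0 mul0r mulr0 subr0 sub0r.
  rewrite oppr_eq0 mulf_eq0 pnatr_eq0 => /orP[/eqP->//|].
  have -> : 1 - 2 = - 1 :> algC by ring.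
  by rewrite oppr_eq0 oner_eq0.
apply: (@poly_eq_off _ _ d).
  by rewrite !mulf_neq0 ?polyXsubC_eq0.
move=> x; rewrite !hornerM !hornerXsubC !mulf_eq0 !negb_or => /andP[/andP[x1 x2]].
rewrite !subr_eq0 in x1 x2.
rewrite !hornerE => qx.
rewrite (char_corona_core H1 deg1) // (char_corona_core H2 deg2) //.
have nE : #|G2|%:R = #|G1|%:R :> algC by rewrite n12.
have pE : #|H2|%:R = #|H1|%:R :> algC by rewrite p12.
rewrite eqH m12 pE nE; congr (_ * _); first by rewrite n12.
set a := x - _ - _ - _ - _ - _.
have a0 : a != 0.
  apply: contraNneq qx => a0.
  rewrite (_ : _ - _ = a * (x - 1) * (x - 2)); first by rewrite a0 !mul0r.
  by rewrite /a /n /p /r; field; rewrite !subr_eq0 x1 x2.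
set b := (x - 1) / (x - 2).
have b0 : b != 0 by rewrite mulf_neq0 ?invr_eq0 ?subr_eq0.
apply: (mulfI (expf_neq0 #|G1| a0)).
rewrite [LHS]det_add_annihilated ?laplacian_const // [in RHS]n12.
rewrite [RHS]det_add_annihilated ?laplacian_const //.
by rewrite !det_affine_char_poly // eqG n12.
Qed.

End CospectralCorona.

(** Either pair of factors may be isomorphic, but not both. *)
Lemma L_cospectral_corona (G1 G2 H1 H2 : graph) :
  regular G1 -> regular G2 ->
  (forall a, eig_mult (laplacian G1) a = eig_mult (laplacian G2) a) ->
  (forall a, eig_mult (laplacian H1) a = eig_mult (laplacian H2) a) ->
  ~ (isomorphic G1 G2 /\ isomorphic H1 H2) ->
  L_cospectral (G1 ⊙ H1) (G2 ⊙ H2).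
Proof.
move=> regG1 regG2 /eq_char_poly eqG /eq_char_poly eqH not_iso; split.
  case=> f f_bij f_adj; apply: not_iso.
  have [n12 p12] := (cospectral_card eqG, cospectral_card eqH).
  by split; [apply: corona_iso_left f_adj | apply: corona_iso_right f_adj].
by move=> a; rewrite /eig_mult (cospectral_corona regG1 regG2 eqG eqH).
Qed.

Theorem corollary3p10 :
  (forall G1 G2 H : graph,
     L_cospectral G1 G2 -> regular H -> L_cospectral (H ⊙ G1) (H ⊙ G2))
  /\
  (forall G1 G2 H : graph,
     L_cospectral G1 G2 -> regular G1 -> regular G2 ->
     L_cospectral (G1 ⊙ H) (G2 ⊙ H))
  /\
  (forall G1 G2 H1 H2 : graph,
     L_cospectral G1 G2 -> regular G1 -> regular G2 ->
     L_cospectral H1 H2 -> regular H1 -> regular H2 ->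
     L_cospectral (G1 ⊙ H1) (G2 ⊙ H2)).
Proof.
split=> [G1 G2 H [noniso cosp] regH|].
  by apply: L_cospectral_corona => // -[].
split=> [G1 G2 H [noniso cosp] regG1 regG2|G1 G2 H1 H2].
  by apply: L_cospectral_corona => // -[].
move=> [nonisoG cospG] regG1 regG2 [_ cospH] _ _.
by apply: L_cospectral_corona => // -[].
Qed.
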